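(* Every VPT-graph has a PSI-representation. That is, for every VPT-graph $G$ there is a family of pseudosegments in the Euclidean plane, in bijection with the vertices of $G$, such that two vertices of $G$ are adjacent if and only if the corresponding pseudosegments intersect.
   Context: Graphs and trees are finite. A graph $G=(V_G,E_G)$ is a VPT-graph (vertex intersection graph of paths on a tree) if there exist a tree $T=(V_T,E_T)$ and a set $\mathcal{P}$ of paths in $T$ together with a mapping $v\mapsto P_v\in\mathcal{P}$ such that, for distinct vertices $v,w$, $vw\in E_G$ if and only if $P_v\cap P_w\neq\emptyset$ (the paths share a node of $T$). Paths consisting of a single node are allowed. A family of pseudosegments is a set of Jordan arcs (simple arcs) in the Euclidean plane that are pairwise either disjoint or intersect in a single point, at which they cross. A family of pseudosegments represents a graph $G$ (is a PSI-representation of $G$) if the vertices of $G$ correspond bijectively to the arcs and two vertices are adjacent if and only if the corresponding arcs intersect. *)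

(* Defs.v *)
From HB Require Import structures.
From mathcomp Require Import all_boot all_order all_algebra.
From mathcomp Require Import all_classical all_reals all_analysis.
Set Implicit Arguments.
Unset Strict Implicit.
Unset Printing Implicit Defensive.
Import Order.TTheory GRing.Theory Num.Theory.
Import numFieldNormedType.Exports.
Local Open Scope classical_set_scope.
Local Open Scope ring_scope.

Record sgraph := SGraph {
  vertex :> finType;
  adj : rel vertex;
  adj_sym : symmetric adj;
  adj_irrefl : irreflexive adj
}.

(* Cycles have at least three nodes: for an edge xy, [:: x; y] already
   satisfies [ucycle]. *)
Definition acyclic (G : sgraph) : Prop :=
  forall c : seq G, (2 < size c)%N -> ~ ucycle (@adj G) c.

Definition connected_graph (G : sgraph) : Prop :=
  forall x y : G, connect (@adj G) x y.

Definition is_tree (T : sgraph) : Prop :=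
  [/\ (0 < #|T|)%N, connected_graph T & acyclic T].

(* A path is represented by its set of nodes (which determines it in a tree);
   [p = [::]] gives the single-node paths. *)
Definition is_path (T : sgraph) (S : {set T}) : Prop :=
  exists x (p : seq T),
    [/\ path (@adj T) x p, uniq (x :: p) & S =i x :: p].

Definition VPT_graph (G : sgraph) : Prop :=
  exists (T : sgraph) (Ps : {set {set T}}) (P : G -> {set T}),
    [/\ is_tree T,
        forall S, S \in Ps -> is_path S,
        forall v, P v \in Ps &
        forall v w : G, v != w -> adj v w = ~~ [disjoint P v & P w]].

(* The plane is R * R, whose product topology is the Euclidean one. *)
Definition Jordan_arc (R : realType) (A : set (R * R)) : Prop :=
  exists f : R -> R * R,
    [/\ {within `[0, 1], continuous f},
        set_inj `[0, 1] f &
        A = f @` `[0, 1]].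

Definition homeomorphism_on (S T : topologicalType) (U : set S) (V : set T)
    (h : S -> T) : Prop :=
  [/\ set_bij U V h, {within U, continuous h} &
      exists k : T -> S,
        {within V, continuous k} /\ (forall x, U x -> k (h x) = x)].

(* Near p, the pair (A, B) looks like the two coordinate axes near the origin,
   up to a homeomorphism between open sets of the plane.  In particular p is
   an endpoint of neither arc, and the arcs do not merely touch at p. *)
Definition cross_at (R : realType) (A B : set (R * R)) (p : R * R) : Prop :=
  exists (U V : set (R * R)) (h : R * R -> R * R),
    [/\ [/\ open U, open V & U p],
        homeomorphism_on U V h,
        h p = (0, 0),
        forall q, U q -> (A q <-> (h q).2 = 0) &
        forall q, U q -> (B q <-> (h q).1 = 0)].

Definition pseudosegments (R : realType) (F : set (set (R * R))) : Prop :=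
  (forall A, F A -> Jordan_arc A) /\
  (forall A B, F A -> F B -> A <> B ->
     A `&` B = set0 \/ exists p, A `&` B = [set p] /\ cross_at A B p).

Definition represents (R : realType) (F : set (set (R * R))) (G : sgraph)
    : Prop :=
  exists A : G -> set (R * R),
    set_bij [set: G] F A /\
    (forall v w : G, v != w -> (adj v w <-> A v `&` A w !=set0)).

Definition PSI_representable (R : realType) (G : sgraph) : Prop :=
  exists F : set (set (R * R)), pseudosegments F /\ represents F G.

(* Main.v *)
Require Import Defs.
From mathcomp Require Import all_boot all_order all_algebra.
From mathcomp Require Import all_classical all_reals all_analysis.
From mathcomp Require Import lra zify.

(** Root the tree at a node r.  Every path P_v of the tree then has a highest
    node t_v, its top, and P_v stays inside the subtree below t_v.  If t_w is
    not strictly below t_v, then P_v and P_w meet exactly when P_w passes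
    through t_v.  If t_w is outside the subtree below t_v, then this happens
    exactly when an end of P_w lies in that subtree, and the two ends cannot
    both do so.

    Give all the path ends distinct abscissas, in such a way that the ends
    lying in a given subtree are consecutive; this is possible because subtrees
    are pairwise nested or disjoint ([laminar_order]).  The arc of v is the
    polygonal line, shaped like the letter Omega,

                        h
                   +---------+
                   |         |
                   |         |
             ------+         |
               -l            |
                             +--------
                                 -r
             x0    x1        x2      x3

    whose two legs stand at the abscissas x1 < x2 of the ends of P_v, and whose
    three horizontal pieces together cover once an interval ]x0, x3[ that
    contains exactly the abscissas of the ends in the subtree below t_v.

    Make l, h, r larger when the subtree below the top is larger.  When w has
    the larger subtree, the legs of w are long enough to cross every horizontal
    piece of v that they face, and the legs of v too short to reach any of w.
    Hence the arcs of v and w meet once for each leg of w in ]x0, x3[; by the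
    first paragraph there is at most one such leg, with one precisely when the
    paths meet ([draw_adjacency_lt]).  Two distinct tops with subtrees of the
    same size have disjoint subtrees, so that the arcs are disjoint as well.

    There remain paths with the same top.  The interval ]x0, x3[ of each then
    contains both legs of the other, and still the arcs have to cross once.
    Among these paths, let l increase with x1 and h = r decrease with x1, with
    l < h throughout.  If v has the leftmost first leg, then only its right leg
    crosses a horizontal piece of w: its left leg is too short for the left
    piece of w, and the legs of w are too short for the middle and right pieces
    of v ([layout_levels], [draw_adjacency_eq]).

    All the crossings are between the interior of a horizontal and of a
    vertical segment, hence genuine ([cross_at_axes]). *)

Set Implicit Arguments.
Unset Strict Implicit.
Unset Printing Implicit Defensive.
Import Order.TTheory GRing.Theory Num.Theory.
Import numFieldNormedType.Exports.

(** * Rooted trees *)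

Section RootedTree.
Variables (T : sgraph) (r : T).
Hypothesis T_connected : connected_graph T.

Definition avoiding (t : T) : rel T :=
  fun x y => [&& adj x y, x != t & y != t].

(** The subtree below [t] is encoded by domination: its nodes are those that
    cannot be reached from the root without visiting [t].  This spares the
    construction of a parent function. *)
Definition descendants (t : T) : {set T} :=
  [set z | ~~ [&& r != t & connect (avoiding t) r z]].

Lemma connect_avoiding_neq (t x z : T) :
  x != t -> connect (avoiding t) x z -> z != t.
Proof.
move=> xt /connectP[p pth ->]; elim: p x xt pth => //= y p IH x xt.
by case/andP=> /and3P[_ _ yt] /(IH _ yt).
Qed.

Lemma descendants_refl t : t \in descendants t.
Proof.
rewrite inE; apply/negP=> /andP[rt /(connect_avoiding_neq rt)].
by rewrite eqxx.
Qed.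

Lemma root_descendants t : (r \in descendants t) = (t == r).
Proof. by rewrite inE connect0 andbT negbK eq_sym. Qed.

Lemma descendants_step t x y :
  adj x y -> x != t -> y != t -> x \notin descendants t ->
  y \notin descendants t.
Proof.
rewrite !inE !negbK => xy xt yt /andP[-> cx] /=.
by apply: connect_trans cx (connect1 _); rewrite /avoiding xy xt.
Qed.

Lemma descendants_const t x p :
  path (@adj T) x p -> t \notin x :: p ->
  {in p, forall z, (z \in descendants t) = (x \in descendants t)}.
Proof.
elim: p x => //= y p IH x /andP[xy pth].
rewrite !in_cons !negb_or => /and3P[tx ty tp].
have e : (y \in descendants t) = (x \in descendants t).
  rewrite eq_sym in tx; rewrite eq_sym in ty.
  apply/idP/idP; apply: contraLR => /descendants_step; apply => //.
  by rewrite adj_sym.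
move=> z; rewrite in_cons => /predU1P[->|zp] //.
by rewrite -e; apply: IH => //; rewrite in_cons negb_or ty.
Qed.

(** One enters or leaves the subtree below [t] through [t] only. *)
Lemma descendants_const_mem t q x y :
  sorted (@adj T) q -> t \notin q -> x \in q -> y \in q ->
  (x \in descendants t) = (y \in descendants t).
Proof.
case: q => // z q /= pth tq.
have H w : w \in z :: q -> (w \in descendants t) = (z \in descendants t).
  by rewrite in_cons => /predU1P[->//|]; apply: descendants_const.
by move=> /H -> /H ->.
Qed.

(** The last clause allows the path to be cut at any of its nodes. *)
Lemma path_from_root z :
  exists q, [/\ sorted (@adj T) q, uniq q, r \in q, z \in q &
    forall q1 q2 w, q = q1 ++ w :: q2 ->
      (w != r -> r \in q1) /\ (w != z -> z \in q2)].
Proof.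
have /connectP[p pth ez] := T_connected r z.
case/shortenP: pth ez => p' pth' up _ ez.
exists (r :: p'); split => //; first by rewrite mem_head.
  by rewrite ez mem_last.
move=> q1 q2 w e; split.
  case: q1 e => [[->]|r' q1 [-> _] _]; first by rewrite eqxx.
  by rewrite mem_head.
have: last r (r :: p') = z by rewrite ez.
rewrite e last_cat /=; case: q2 e => /= [|y q2] e <-; first by rewrite eqxx.
by rewrite mem_last.
Qed.

Lemma descendants_trans s t :
  s \in descendants t -> descendants s \subset descendants t.
Proof.
have [<-|st] := eqVneq s t; first by [].
have [->|sr] := eqVneq s r.
  by rewrite root_descendants => /eqP ->.
move=> sdt; apply/fintype.subsetP => z zs; apply/negPn/negP.
rewrite inE negbK => /andP[rt /connectP[p pth ez]].
have pth' : path (@adj T) r p.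
  by apply: sub_path pth => x y /and3P[].
have tp w : w \in p -> w \notin descendants t.
  move=> wp; rewrite inE negbK rt /=; apply: (path_connect pth).
  by rewrite in_cons wp orbT.
have sp : s \notin r :: p.
  rewrite in_cons negb_or sr /=; apply/negP => /tp.
  by rewrite sdt.
have zp : z \in r :: p by rewrite ez mem_last.
have := descendants_const_mem (q := r :: p) pth' sp zp (mem_head _ _).
by rewrite zs root_descendants (negPf sr).
Qed.

(** A simple path from the root to [s] visits [t] first, and thus reaches [t]
    avoiding [s]. *)
Lemma descendants_antisym s t :
  s \in descendants t -> t \in descendants s -> s = t.
Proof.
move=> st ts; apply/eqP/negPn/negP => neq.
have [q [sq uq rq sinq hq]] := path_from_root s.
have [tr|tr] := eqVneq t r.
  by move: ts; rewrite tr root_descendants -tr (negPf neq).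
have tq : t \in q.
  apply/negPn/negP => ntq.
  have := descendants_const_mem sq ntq sinq rq.
  by rewrite st root_descendants (negPf tr).
case/splitPr: q / tq sq uq rq sinq hq => q1 q2 sq uq rq sinq hq.
have [/(_ tr) rq1 /(_ _)] := hq _ _ _ erefl.
rewrite eq_sym => /(_ neq) sq2.
have nsq : s \notin rcons q1 t.
  move: uq; rewrite -cat_rcons cat_uniq => /and3P[_ /hasPn/(_ _ sq2) + _] //.
have sq' : sorted (@adj T) (rcons q1 t).
  by move: sq; rewrite -cat_rcons => /cat_sorted2[].
have := descendants_const_mem sq' nsq (x := t) (y := r).
rewrite !mem_rcons mem_head inE rq1 orbT ts root_descendants.
move=> /(_ isT isT)/esym/eqP sr.
by move: st; rewrite sr root_descendants (negPf tr).
Qed.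

(** A path from the root to a common node [z] of both subtrees visits [s] and
    [t]; the part of it from the last of the two on avoids the other one, hence
    stays in the subtree below that other one, as [z] does. *)
Lemma descendants_laminar s t :
  [\/ descendants s \subset descendants t, descendants t \subset descendants s
    | [disjoint descendants s & descendants t]].
Proof.
case: (boolP [disjoint _ & _]) => [|/pred0Pn[z /andP[/= zs zt]]].
  by constructor 3.
suff: (s \in descendants t) || (t \in descendants s).
  by case/orP=> /descendants_trans; [constructor 1|constructor 2].
have [q [sq uq rq zq hq]] := path_from_root z.
have inq w : z \in descendants w -> (w == r) || (w \in q).
  move=> zw; apply/orP; have [|b] := boolP (w \in q); [by right|left].
  have := descendants_const_mem sq b zq rq.
  by rewrite zw root_descendants.
have rootT w : w \in descendants r by rewrite inE eqxx.
have [->|tr] := eqVneq t r; first by rewrite rootT.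
have [->|sr] := eqVneq s r; first by rewrite rootT orbT.
have tq : t \in q by have := inq t zt; rewrite (negPf tr).
have sq' : s \in q by have := inq s zs; rewrite (negPf sr).
have [->|neq] := eqVneq s t; first by rewrite descendants_refl.
case/splitPr: q / tq sq uq rq zq hq sq' {inq} => q1 q2 sq uq rq zq hq sq'.
have [zeqt|zt'] := eqVneq z t; first by rewrite -zeqt zs orbT.
have [_ /(_ _)] := hq _ _ _ erefl; rewrite eq_sym => /(_ zt') zq2.
move: uq; rewrite cat_uniq /= => /and3P[_ nq12 /andP[tq2 uq2]].
have stq : sorted (@adj T) (t :: q2) by case/cat_sorted2: sq.
have sq2 : sorted (@adj T) q2 by case/path_sorted: stq.
rewrite mem_cat in_cons (negPf neq) /= in sq'.
case/orP: sq' => [sq1|sq2'].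
  have nsq : s \notin t :: q2.
    rewrite in_cons (negPf neq); apply/negP => sq2'; case/negP: nq12.
    by apply/orP; right; apply/hasP; exists s.
  have := descendants_const_mem stq nsq (mem_head _ _) (_ : z \in t :: q2).
  by rewrite in_cons zq2 orbT zs => ->//; rewrite orbT.
by rewrite (descendants_const_mem sq2 tq2 sq2' zq2) zt.
Qed.

Hypothesis T_acyclic : acyclic T.

(** The tree with the edge between [x] and [y] removed. *)
Definition bypassing (x y : T) : rel T :=
  fun a b => [&& adj a b, ~~ ((a == x) && (b == y)) & ~~ ((a == y) && (b == x))].

Lemma bypassing_sym x y : connect_sym (bypassing x y).
Proof.
apply: sym_connect_sym => a b; rewrite /bypassing (adj_sym a).
by rewrite [(b == y) && _]andbC [(b == x) && _]andbC; congr (_ && _); rewrite andbC.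
Qed.

(** A simple path between the ends of an edge, other than this edge, closes up
    to a cycle. *)
Lemma edge_is_bridge x y : adj x y -> ~~ connect (bypassing x y) x y.
Proof.
move=> xy; apply/negP => /connectP[p pth ey].
case/shortenP: pth ey => -[|a [|b p']] pth' up _ /= ey.
- by rewrite ey adj_irrefl in xy.
- by move: pth'; rewrite /= /bypassing ey !eqxx /= andbF.
have pc : path (@adj T) x [:: a, b & p'].
  by apply: sub_path pth' => u v /and3P[].
apply: (T_acyclic (c := [:: x, a, b & p'])) => //.
rewrite /ucycle up andbT /cycle rcons_path pc /=.
by rewrite -ey adj_sym.
Qed.

Lemma connect_avoiding_bypassing t z x y :
  connect (avoiding t) x y -> connect (bypassing t z) x y.
Proof.
apply: connect_sub => a b /and3P[ab at' bt]; apply: connect1.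
by rewrite /bypassing ab (negPf at') (negPf bt) andbF.
Qed.

Lemma bypassingC x y : bypassing x y =2 bypassing y x.
Proof. by move=> a b; rewrite /bypassing; congr (_ && _); rewrite andbC. Qed.

(** Otherwise the root would reach [t] avoiding [z] and [z] avoiding [t], and
    the two walks would join [t] to [z] without their edge. *)
Lemma adj_descendants t z :
  adj t z -> z \notin descendants t -> t \in descendants z.
Proof.
move=> tz; rewrite inE negbK => /andP[_ rz]; apply/negPn/negP.
rewrite inE negbK => /andP[_ rt].
case/negP: (edge_is_bridge tz).
apply: connect_trans (connect_avoiding_bypassing z rz).
rewrite bypassing_sym (eq_connect (bypassingC t z)).
exact: connect_avoiding_bypassing.
Qed.

(** Two distinct such neighbours would be joined, through the root, by a walk avoiding
    [t], which bypasses the edge from [t] to [z]. *)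
Lemma unique_parent t z z' :
  adj t z -> adj t z' -> z \notin descendants t -> z' \notin descendants t ->
  z = z'.
Proof.
move=> tz tz'; rewrite !inE !negbK => /andP[rt rz] /andP[_ rz'].
apply/eqP/negPn/negP => neq; case/negP: (edge_is_bridge tz).
apply: connect_trans (connect_avoiding_bypassing z rz).
rewrite bypassing_sym.
apply: connect_trans (connect_avoiding_bypassing z rz') (connect1 _).
by rewrite /bypassing adj_sym tz' (negPf (connect_avoiding_neq rt rz')) (eq_sym z')
  (negPf neq).
Qed.

(** A path leaving the subtree below [t] and coming back would visit [t]
    twice. *)
Lemma path_ends_in d s t : sorted (@adj T) s -> uniq s ->
  head d s \in descendants t -> last d s \in descendants t ->
  {subset s <= descendants t}.
Proof.
move=> ss us hs ls z zs; have [ts|ts] := boolP (t \in s); last first.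
  rewrite (descendants_const_mem (y := head d s) ss ts zs) //.
  by case: (s) zs => // a q _; apply: mem_head.
case/splitPr: s / ts ss us hs ls zs => q1 q2.
rewrite last_cat mem_cat cat_uniq /= => ss.
rewrite negb_or => /and4P[uq1 /andP[tq1 _] tq2 uq2] hs ls.
have sq1 : sorted (@adj T) q1 by case/cat_sorted2: ss.
have sq2 : sorted (@adj T) q2 by case/cat_sorted2: ss => _ /path_sorted.
case/orP=> [zq1|]; last rewrite in_cons => /predU1P[->|zq2].
- rewrite (descendants_const_mem (y := head d q1) sq1 tq1 zq1).
    by case: (q1) hs zq1.
  by case: (q1) zq1 => // ? ? _; apply: mem_head.
- exact: descendants_refl.
- rewrite (descendants_const_mem (y := last t q2) sq2 tq2 zq2) //.
  by case: (q2) zq2 => //= ? ? _; apply: mem_last.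
Qed.

(** A path entering the subtree below [t] and leaving it again would do so from
    the parent of [t] and to the parent of [t]. *)
Lemma path_ends_out d s t : sorted (@adj T) s -> uniq s ->
  head d s \notin descendants t -> last d s \notin descendants t ->
  {in s, forall z, z \notin descendants t}.
Proof.
move=> ss us hs ls z zs; have [ts|ts] := boolP (t \in s); last first.
  rewrite (descendants_const_mem (y := head d s) ss ts zs) //.
  by case: (s) zs => // a q _; apply: mem_head.
case/splitPr: s / ts ss us hs ls zs => q1 q2.
case/lastP: q1 => [|q1 y] /=; first by rewrite descendants_refl.
case: q2 => [|y' q2]; first by rewrite last_cat /= descendants_refl.
have -> : head d (rcons q1 y ++ [:: t, y' & q2]) = head d (rcons q1 y).
  by case: (q1).
rewrite last_cat cat_uniq /= => ss.
rewrite negb_or => /and4P[uq1 /andP[tq1 +] tq2 uq2] hs ls _.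
rewrite negb_or mem_rcons in_cons negb_or => /andP[/andP[neq _] _].
have [sq1 /= /andP[ty' sq2]] := cat_sorted2 ss.
have ty : adj t y.
  move: ss; rewrite cat_rcons => /cat_sorted2[_ /= /andP[]].
  by rewrite adj_sym => ->.
case/eqP: neq; apply: (unique_parent ty' ty).
  rewrite (descendants_const_mem (y := last y' q2) (q := y' :: q2)) ?mem_head //.
  exact: mem_last.
rewrite (descendants_const_mem (y := head d (rcons q1 y)) sq1 tq1) //.
  by rewrite mem_rcons mem_head.
by case: (q1) => [|? ?] /=; apply: mem_head.
Qed.

(** The top is a node of the path with the largest subtree: a node of the path
    outside this subtree would force a neighbour of the top on the path to be
    outside too, and this neighbour would have a larger subtree. *)
Lemma path_top x p : path (@adj T) x p -> uniq (x :: p) ->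
  exists2 t, t \in x :: p & {subset x :: p <= descendants t}.
Proof.
move=> pth up; have [t ts tmax] := @arg_maxnP _ x (mem (x :: p))
  (fun t => #|descendants t|) (mem_head _ _).
exists t => // z zs; apply/negPn/negP => zt.
suff [w [ws tw wt]] : exists w, [/\ w \in x :: p, adj t w & w \notin descendants t].
  have := tmax w ws; apply/negP; rewrite -ltnNge; apply: proper_card.
  apply/properP; split; last by exists w => //; apply: descendants_refl.
  exact/descendants_trans/adj_descendants.
have ss : sorted (@adj T) (x :: p) by [].
move: (x :: p) ts zs ss up zt => s ts zs ss us zt {tmax}.
case/splitPr: s / ts zs ss us => q1 q2; rewrite mem_cat cat_uniq /= => zs ss.
rewrite negb_or => /and4P[_ /andP[tq1 _] tq2 _].
have sq1 : sorted (@adj T) q1 by case/cat_sorted2: ss.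
have sq2 : sorted (@adj T) q2 by case/cat_sorted2: ss => _ /path_sorted.
case/orP: zs => [zq|]; last rewrite in_cons => /predU1P[ezt|zq].
- case/lastP: q1 ss tq1 sq1 zq => // q1 y ss tq1 sq1 zq.
  exists y; split.
  + by rewrite mem_cat mem_rcons mem_head.
  + by move: ss; rewrite cat_rcons => /cat_sorted2[_ /= /andP[+ _]]; rewrite adj_sym.
  + rewrite (descendants_const_mem (y := z) sq1 tq1) //.
    by rewrite mem_rcons mem_head.
- by rewrite ezt descendants_refl in zt.
- case: q2 ss tq2 sq2 zq => // y q2 ss tq2 sq2 zq.
  exists y; split.
  + by rewrite mem_cat !in_cons eqxx !orbT.
  + by case/cat_sorted2: ss => _ /= /andP[].
  + by rewrite (descendants_const_mem (y := z) sq2 tq2) // mem_head.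
Qed.

(** All that the drawing uses of a path [S] with ends [x] and [y] and top
    [t]. *)
Definition spans (S : {set T}) (x y t : T) : Prop :=
  [/\ x \in S, y \in S, t \in S & S \subset descendants t] /\
  forall z,
    [/\ x \in descendants z -> y \in descendants z -> S \subset descendants z,
        x \notin descendants z -> y \notin descendants z ->
          [disjoint S & descendants z] &
        x \in descendants z != (y \in descendants z) -> z \in S].

Lemma path_spans (S : {set T}) : is_path S -> exists x y t, spans S x y t.
Proof.
move=> [x [p [pth up eS]]]; have [t tp pt] := path_top pth up.
have ss : sorted (@adj T) (x :: p) by [].
have lp : last x p \in x :: p := mem_last x p.
exists x, (last x p), t; split.
  by rewrite !eS mem_head lp tp; split=> //; apply/fintype.subsetP => z; rewrite eS; apply: pt.
move=> z; split=> [xz yz|xz yz|xy].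
- apply/fintype.subsetP => w; rewrite eS; exact: (path_ends_in (d := x) ss).
- rewrite disjoint_subset; apply/fintype.subsetP => w; rewrite eS.
  exact: (path_ends_out (d := x) ss).
- rewrite eS; apply: contraNT xy => zp.
  by rewrite (descendants_const_mem ss zp (mem_head _ _) lp).
Qed.

End RootedTree.
(** * Orders making a laminar family convex *)

Definition convex_for (S : finType) (f : S -> nat) (A : {set S}) :=
  forall p q m, p \in A -> q \in A -> f p <= f m <= f q -> m \in A.

Definition nested_or_disjoint (S : finType) (A B : {set S}) :=
  [\/ A \subset B, B \subset A | [disjoint A & B]].

(** Starting from an order [f] that suits the other sets, move all of [A] to the
    place of one of its elements [a], without reordering it.  This makes
    [A] convex.  A set containing [A] stays convex since it contains [a], a set
    contained in [A] since the order inside [A] is kept, and a set disjoint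
    from [A] since it does not contain [a]. *)
Lemma laminar_order (S : finType) (F : seq {set S}) :
  {in F &, forall A B, nested_or_disjoint A B} ->
  exists2 f : S -> nat, injective f & {in F, forall A, convex_for f A}.
Proof.
elim: F => [_|A F IH lam].
  by exists (fun x => nat_of_ord (enum_rank x)) => // x y /ord_inj/enum_rank_inj.
have [|f finj fcvx] := IH.
  by move=> B C BF CF; apply: lam; rewrite in_cons ?BF ?CF orbT.
have [->|[a aA]] := set_0Vmem A.
  exists f => // B; rewrite in_cons => /predU1P[->|]; last exact: fcvx.
  by move=> p; rewrite inE.
(* [g] sorts by [f'], which collapses [A] to [a], and then by [f]. *)
pose f' x := if x \in A then f a else f x.
pose N := (\max_x f x).+1.
have fN x : f x < N by rewrite ltnS (leq_bigmax x).
pose g x := f' x * N + f x.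
have g_le x y : g x <= g y -> f' x <= f' y /\ (f' x = f' y -> f x <= f y).
  by rewrite /g; have := fN x; have := fN y; nia.
exists g.
  move=> x y exy; apply: finj; have [] := (g_le x y, g_le y x).
  rewrite exy leqnn => -[]// ? h1 [] // ? h2; apply/eqP; rewrite eqn_leq.
  by rewrite h1 ?h2 //; lia.
move=> B BAF p q m pB qB /andP[/g_le[pm1 pm2] /g_le[mq1 mq2]].
have [BA|BF] : B = A \/ B \in F by apply/predU1P.
  subst B; move: pm1 mq1; rewrite /f' pB qB; case: ifP => // mA h1 h2.
  by move: mA; rewrite (_ : m = a) ?aA //; apply: finj; lia.
have cvx := fcvx B BF; move: pm1 pm2 mq1 mq2; rewrite /f'.
have [||AB|BA|dAB] := lam A B; rewrite ?mem_head ?in_cons ?BF ?orbT //.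
- have aB := fintype.subsetP AB a aA.
  case: (boolP (m \in A)) => [mA _ _ _ _|mA]; first exact: (fintype.subsetP AB).
  case: (p \in A); case: (q \in A) => h1 _ h2 _.
  + by apply: (cvx a a); rewrite ?h1 ?h2.
  + by apply: (cvx a q); rewrite ?h1 ?h2.
  + by apply: (cvx p a); rewrite ?h1 ?h2.
  + by apply: (cvx p q); rewrite ?h1 ?h2.
- have pA := fintype.subsetP BA p pB; have qA := fintype.subsetP BA q qB.
  rewrite pA qA; case: (boolP (m \in A)) => [mA _ h1 _ h2|mA h1 _ h2 _].
    by apply: (cvx p q) => //; rewrite h1 ?h2.
  by case/negP: mA; rewrite (_ : m = a) //; apply: finj; lia.
- have nA x : x \in B -> (x \in A) = false.
    by move=> xB; apply/negP => xA; move: (disjointFr dAB xA); rewrite xB.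
  rewrite (nA _ pB) (nA _ qB); case: (boolP (m \in A)) => [mA h1 _ h2 _|mA h1 _ h2 _].
    have aB : a \in B by apply: (cvx p q) => //; rewrite h1.
    by have := nA a aB; rewrite aA.
  by apply: (cvx p q) => //; rewrite h1.
Qed.

(** * From paths in a tree to positions on a line *)

Lemma convex_hull (S : finType) (f : S -> nat) (A : {set S}) (s0 : S) :
  convex_for f A -> s0 \in A ->
  exists s12 : S * S, [/\ s12.1 \in A, s12.2 \in A &
    forall s, (s \in A) = (f s12.1 <= f s <= f s12.2)].
Proof.
move=> cvx s0A.
have [m mA mmin] := @arg_minnP _ s0 (mem A) f s0A.
have [M MA Mmax] := @arg_maxnP _ s0 (mem A) f s0A.
exists (m, M); split=> // s; apply/idP/idP => [sA|]; last exact: cvx.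
by rewrite mmin //=; apply: Mmax.
Qed.

Definition strictly_inside (n l h : nat) := l < n < h.
Definition strictly_outside (n l h : nat) := (n < l) || (h < n).

(** The positions of the vertical legs [x1], [x2] and of the ends [x0], [x3] of
    the arcs.  [H] measures the subtree below the top.  The third clause
    concerns an arc [v] and the legs of an arc [w] with a larger subtree; in the
    fourth one, either the tops are equal or the subtrees are disjoint. *)
Definition layout (G : sgraph) (x0 x1 x2 x3 H : G -> nat) : Prop :=
  [/\ forall v, [/\ x0 v < x1 v, x1 v < x2 v & x2 v < x3 v],
      forall v w, v != w -> [/\ x1 v != x1 w, x1 v != x2 w & x2 v != x2 w],
      forall v w, H v < H w ->
        if adj v w then
          strictly_inside (x1 w) (x0 v) (x3 v) && strictly_outside (x2 w) (x0 v) (x3 v) ||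
          strictly_outside (x1 w) (x0 v) (x3 v) && strictly_inside (x2 w) (x0 v) (x3 v)
        else strictly_outside (x1 w) (x0 v) (x3 v) && strictly_outside (x2 w) (x0 v) (x3 v) &
      forall v w, H v = H w -> v != w ->
        if adj v w then
          strictly_inside (x1 w) (x0 v) (x3 v) && strictly_inside (x2 w) (x0 v) (x3 v)
        else (x3 v < x0 w) || (x3 w < x0 v)].

(** [H] is the size of the subtree below the top: for nested subtrees it
    decides which one is larger, and subtrees of equal size are equal or
    disjoint. *)
Lemma VPT_layout (G : sgraph) : VPT_graph G ->
  exists x0 x1 x2 x3 H : G -> nat, layout x0 x1 x2 x3 H.
Proof.
move=> [T [Ps [P [[/card_gt0P[r _] Tc Ta] Psp PPs adjP]]]].
have /choice[e he] v : exists e : T * T * T,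
    spans r (P v) e.1.1 e.1.2 e.2.
  have [x [y [t h]]] := path_spans r Ta (Psp _ (PPs v)).
  by exists (x, y, t).
pose D := descendants r.
(* The two ends of the path of [v] are indexed by [(v, false)] and
   [(v, true)], so that paths ending at the same node get distinct legs. *)
pose en (s : G * bool) := if s.2 then (e s.1).1.2 else (e s.1).1.1.
pose top v := (e v).2.
pose A t := [set s | en s \in D t].
have inA s t : (s \in A t) = (en s \in D t) by rewrite finset.in_set.
have disA s t : [disjoint D s & D t] -> [disjoint A s & A t].
  by move=> dst; apply/pred0P => z /=; rewrite !inA; apply: (pred0P dst (en z)).
have [|f finj fcvx] := @laminar_order _ [seq A t | t : T].
  move=> _ _ /fintype.imageP[s _ ->] /fintype.imageP[t _ ->].
  have [st|ts|dst] := descendants_laminar r Tc s t.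
  - by constructor 1; apply/fintype.subsetP => z; rewrite !inA; apply: (fintype.subsetP st).
  - by constructor 2; apply/fintype.subsetP => z; rewrite !inA; apply: (fintype.subsetP ts).
  - by constructor 3; apply: disA.
have enP s : en s \in P s.1.
  by rewrite /en; have [[? ? _ _] _] := he s.1; case: ifP.
have enA s : s \in A (top s.1).
  have [[_ _ _ sub] _] := he s.1; rewrite inA; apply: (fintype.subsetP sub).
  exact: enP.
have cvxA v : convex_for f (A (top v)) by apply: fcvx; apply: fintype.image_f.
have [s12 hs12] := choice (fun v => convex_hull (cvxA v) (enA (v, false))).
pose m v := f (s12 v).1; pose M v := f (s12 v).2.
have AE v s : (s \in A (top v)) = (m v <= f s <= M v) by have [] := hs12 v.
have mM v : m v <= M v.
  by have [h _ _] := hs12 v; rewrite AE in h; case/andP: h.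
have Mm v w : [disjoint A (top v) & A (top w)] -> (M v < m w) || (M w < m v).
  have [v1 v2 vE] := hs12 v; have [w1 w2 wE] := hs12 w.
  move=> dvw; rewrite !ltnNge -negb_and; apply/negP => /andP[h1 h2].
  move: (disjointFl dvw w1) (disjointFr dvw v1); rewrite !AE -/(m v) -/(m w).
  by move: (mM v) (mM w); lia.
pose b v := f (v, true) < f (v, false).
pose p1 v := (v, b v); pose p2 v := (v, ~~ b v).
have p12 v : f (p1 v) < f (p2 v).
  have : f (v, true) != f (v, false) by apply/eqP => /finj[].
  by rewrite /p1 /p2 /b; case: (ltnP (f (v, true)) (f (v, false))) => h /=; lia.
have p1A v : p1 v \in A (top v) := enA (p1 v).
have p2A v : p2 v \in A (top v) := enA (p2 v).
have neq_slot (v w : G) c d : v != w -> f (v, c) != f (w, d).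
  by move=> vw; apply/eqP => /finj[/eqP]; rewrite (negPf vw).
(* The factor 3 leaves room between consecutive ends for the two limits of the
   intervals, one from each side. *)
pose pos s := 3 * f s + 3.
have posW v s : strictly_inside (pos s) (3 * m v + 2) (3 * M v + 4) = (s \in A (top v)).
  by rewrite AE /strictly_inside /pos; lia.
have posB v s : strictly_outside (pos s) (3 * m v + 2) (3 * M v + 4) = (s \notin A (top v)).
  by rewrite AE /strictly_outside /pos; lia.
have endsA v w : (p1 w \in A (top v)) && (p2 w \in A (top v)) =
    ((e w).1.1 \in D (top v)) && ((e w).1.2 \in D (top v)).
  by rewrite /p1 /p2 !inA /en /=; case: (b w) => //=; rewrite andbC.
have endsO v w : (p1 w \in A (top v)) || (p2 w \in A (top v)) =
    ((e w).1.1 \in D (top v)) || ((e w).1.2 \in D (top v)).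
  by rewrite /p1 /p2 !inA /en /=; case: (b w) => //=; rewrite orbC.
have meet v w z : v != w -> z \in P v -> z \in P w -> adj v w.
  move=> vw zv zw; rewrite adjP //; apply/pred0Pn; exists z.
  by rewrite /= zv zw.
have sub v : P v \subset D (top v) by have [[_ _ _ ?] _] := he v.
have topP v : top v \in P v by have [[_ _ ? _] _] := he v.
have apart v w : v != w -> [disjoint D (top v) & P w] -> adj v w = false.
  move=> vw dvw; rewrite adjP // (disjointWl (sub v)) //.
exists (fun v => 3 * m v + 2), (fun v => pos (p1 v)), (fun v => pos (p2 v)),
  (fun v => 3 * M v + 4), (fun v => #|D (top v)|); split=> [v|v w vw|v w Hvw|v w Hvw vw].
- have := p1A v; have := p2A v; have := p12 v.
  by rewrite !AE /pos; split; lia.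
- have h1 := neq_slot v w (b v) (b w) vw.
  have h2 := neq_slot v w (b v) (~~ b w) vw.
  have h3 := neq_slot v w (~~ b v) (~~ b w) vw.
  rewrite /pos -/(p1 v) -/(p1 w) -/(p2 v) -/(p2 w) in h1 h2 h3 *.
  split; lia.
- have vw : v != w by apply: contraTneq Hvw => ->; rewrite ltnn.
  have [hin hout hmix] := (he w).2 (top v).
  move: (endsA v w) (endsO v w); rewrite !posW !posB.
  have nsub : ~~ (P w \subset D (top v)).
    apply/negP => /fintype.subsetP/(_ _ (topP w))/descendants_trans/subset_leq_card.
    by rewrite leqNgt Hvw.
  move: hin hout hmix; rewrite -/(D (top v)).
  case: (_ \in D (top v)); case: (_ \in D (top v)) => hin hout hmix /=.
  + by rewrite hin in nsub.
  + rewrite (meet _ _ _ vw (topP v) (hmix isT)).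
    by case: (p1 w \in _); case: (p2 w \in _).
  + rewrite (meet _ _ _ vw (topP v) (hmix isT)).
    by case: (p1 w \in _); case: (p2 w \in _).
  + rewrite apart // 1?disjoint_sym ?hout //.
    by case: (p1 w \in _); case: (p2 w \in _).
- have [etop|ntop] := eqVneq (top v) (top w).
    rewrite (meet _ _ _ vw (topP v)) ?etop ?topP // !posW !etop.
    by rewrite p1A p2A.
  have dD : [disjoint D (top v) & D (top w)].
    have anti s t : D s \subset D t -> #|D s| = #|D t| -> s = t.
      move=> st est; have est' : D t = D s.
        by apply/eqP; rewrite eq_sym eqEcard st est leqnn.
      apply: (descendants_antisym Tc).
        by apply: (fintype.subsetP st); apply: descendants_refl.
      by rewrite -/(D s) -est'; apply: descendants_refl.
    case: (descendants_laminar r Tc (top v) (top w)) => // h; case/eqP: ntop.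
      exact: anti.
    by apply/esym/anti.
  rewrite apart //; last exact: disjointWr (sub w) dD.
  by case/Mm/orP: (disA _ _ dD) => h; apply/orP; [left|right]; lia.
Qed.

Local Open Scope classical_set_scope.
Local Open Scope ring_scope.

(** * Omega-shaped arcs *)

Lemma continuous_pair (S T T' : topologicalType) (f : S -> T) (g : S -> T') :
  continuous f -> continuous g -> continuous (fun x => (f x, g x)).
Proof.
move=> fc gc x.
exact: (@cvg_pair _ _ _ _ (nbhs (f x)) (nbhs (g x)) _ _ _ f g (fc x) (gc x)).
Qed.

Section Clamp.
Variable R : realType.
Implicit Types a b s : R.

Definition clamp a b s : R := Num.min (Num.max s a) b.

Lemma clamp_continuous a b : continuous (clamp a b).
Proof.
move=> s; apply: (@continuous_min R R (fun s => Num.max s a) (fun=> b)).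
  by apply: (@continuous_max R R id (fun=> a)); [exact: cvg_id|exact: cvg_cst].
exact: cvg_cst.
Qed.

Lemma clamp_below a b s : a <= b -> s <= a -> clamp a b s = a.
Proof. by move=> ab sa; rewrite /clamp (max_idPr sa) (min_idPl ab). Qed.

Lemma clamp_inside a b s : a <= s <= b -> clamp a b s = s.
Proof. by move=> /andP[sa ab]; rewrite /clamp (max_idPl sa) (min_idPl ab). Qed.

Lemma clamp_above a b s : a <= b -> b <= s -> clamp a b s = b.
Proof.
move=> ab bs; rewrite /clamp (max_idPl (le_trans ab bs)).
exact/min_idPr.
Qed.

End Clamp.

Section Arch.
Variable R : realType.

Record arch := Arch {
  left_end : R; leg1 : R; leg2 : R; right_end : R;
  bottom1 : R; height : R; bottom2 : R }.

Definition well_formed (u : arch) :=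
  [/\ left_end u < leg1 u, leg1 u < leg2 u, leg2 u < right_end u &
   [/\ 0 < bottom1 u, 0 < height u & 0 < bottom2 u]].

Definition horizontals (u : arch) : set (R * R) :=
  [set q | [\/ left_end u <= q.1 <= leg1 u /\ q.2 = - bottom1 u,
               leg1 u <= q.1 <= leg2 u /\ q.2 = height u |
               leg2 u <= q.1 <= right_end u /\ q.2 = - bottom2 u]].

Definition verticals (u : arch) : set (R * R) :=
  [set q | (q.1 = leg1 u /\ - bottom1 u <= q.2 <= height u) \/
           (q.1 = leg2 u /\ - bottom2 u <= q.2 <= height u)].

Definition curve (u : arch) : set (R * R) := horizontals u `|` verticals u.

(** The arc is parametrized by arc length: the corners are reached at [s1], ...,
    [s4] and the last end at [s5].  Each coordinate is a sum of clamped copies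
    of the parameter, one for each side along which it varies. *)
Section Parametrization.
Variables (u : arch) (s1 s2 s3 s4 s5 : R).
Hypothesis s_incr : [/\ 0 < s1, s1 < s2, s2 < s3, s3 < s4 & s4 < s5].
Hypothesis s_lengths :
  [/\ leg1 u = left_end u + s1, height u = - bottom1 u + (s2 - s1),
      leg2 u = leg1 u + (s3 - s2), - bottom2 u = height u - (s4 - s3) &
      right_end u = leg2 u + (s5 - s4)].

Definition param_x s :=
  left_end u + clamp 0 s1 s + (clamp s2 s3 s - s2) + (clamp s4 s5 s - s4).
Definition param_y s :=
  - bottom1 u + (clamp s1 s2 s - s1) - (clamp s3 s4 s - s3).

Lemma param_pieces (s : R) : 0 <= s <= s5 ->
  [\/ 0 <= s <= s1 /\ (param_x s = left_end u + s /\ param_y s = - bottom1 u),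
      s1 <= s <= s2 /\ (param_x s = leg1 u /\ param_y s = - bottom1 u + (s - s1)) |
  [\/ s2 <= s <= s3 /\ (param_x s = leg1 u + (s - s2) /\ param_y s = height u),
      s3 <= s <= s4 /\ (param_x s = leg2 u /\ param_y s = height u - (s - s3)) |
      s4 <= s <= s5 /\ (param_x s = leg2 u + (s - s4) /\ param_y s = - bottom2 u)]].
Proof.
have [b1 b2 b3 b4 b5] := s_incr; have [e1 e2 e3 e4 e5] := s_lengths.
move=> /andP[s_ge0 s_le5].
have below a b : a < b -> s <= a -> clamp a b s = a.
  by move=> /ltW; apply: clamp_below.
have above a b : a < b -> b <= s -> clamp a b s = b.
  by move=> /ltW; apply: clamp_above.
have inside a b : a <= s -> s <= b -> clamp a b s = s.
  by move=> sa sb; apply: clamp_inside; rewrite sa.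
have cmp a : s <= a \/ a <= s by apply/orP/le_total.
rewrite /param_x /param_y.
have [t1|t1] := cmp s1.
  constructor 1; rewrite (inside 0 s1) // (below s1 s2) // (below s2 s3); try lra.
  by rewrite (below s3 s4) ?(below s4 s5); lra.
rewrite (above 0 s1) //; have [t2|t2] := cmp s2.
  constructor 2; rewrite (inside s1 s2) // (below s2 s3) // (below s3 s4); try lra.
  by rewrite (below s4 s5); lra.
rewrite (above s1 s2) //; have [t3|t3] := cmp s3.
  constructor 3; constructor 1; rewrite (inside s2 s3) // (below s3 s4) // (below s4 s5); lra.
rewrite (above s2 s3) //; have [t4|t4] := cmp s4.
  constructor 3; constructor 2; rewrite (inside s3 s4) // (below s4 s5) //; lra.
rewrite (above s3 s4) // (inside s4 s5) //.
constructor 3; constructor 3; lra.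
Qed.

Lemma param_x_continuous : continuous param_x.
Proof.
move=> s; apply: cvgD; first (apply: cvgD; first (apply: cvgD; first exact: cvg_cst)).
- exact: clamp_continuous.
- by apply: cvgB; [exact: clamp_continuous|exact: cvg_cst].
- by apply: cvgB; [exact: clamp_continuous|exact: cvg_cst].
Qed.

Lemma param_y_continuous : continuous param_y.
Proof.
move=> s; apply: cvgB; first (apply: cvgD; first exact: cvg_cst).
- by apply: cvgB; [exact: clamp_continuous|exact: cvg_cst].
- by apply: cvgB; [exact: clamp_continuous|exact: cvg_cst].
Qed.

Lemma param_inj (s s' : R) : 0 <= s <= s5 -> 0 <= s' <= s5 ->
  param_x s = param_x s' -> param_y s = param_y s' -> s = s'.
Proof.
have [b1 b2 b3 b4 b5] := s_incr; have [e1 e2 e3 e4 e5] := s_lengths.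
by move=> /param_pieces[|| []] [? [-> ->]] /param_pieces[|| []] [? [-> ->]]; lra.
Qed.

Lemma param_image q :
  curve u q <-> exists2 s : R, 0 <= s <= s5 & (param_x s, param_y s) = q.
Proof.
have [b1 b2 b3 b4 b5] := s_incr; have [e1 e2 e3 e4 e5] := s_lengths.
split=> [|[s + <-] /=].
  have at_ (s : R) : 0 <= s <= s5 -> param_x s = q.1 /\ param_y s = q.2 ->
      exists2 s : R, 0 <= s <= s5 & (param_x s, param_y s) = q.
    by move=> hs [ex ey]; exists s => //; rewrite ex ey -surjective_pairing.
  case=> [[]|[]] [h1 h2].
  - have hs : 0 <= q.1 - left_end u <= s5 by lra.
    by apply: (at_ _ hs); case/param_pieces: hs => [|| []] [? [-> ->]]; lra.
  - have hs : 0 <= s2 + (q.1 - leg1 u) <= s5 by lra.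
    by apply: (at_ _ hs); case/param_pieces: hs => [|| []] [? [-> ->]]; lra.
  - have hs : 0 <= s4 + (q.1 - leg2 u) <= s5 by lra.
    by apply: (at_ _ hs); case/param_pieces: hs => [|| []] [? [-> ->]]; lra.
  - have hs : 0 <= s1 + (q.2 + bottom1 u) <= s5 by lra.
    by apply: (at_ _ hs); case/param_pieces: hs => [|| []] [? [-> ->]]; lra.
  - have hs : 0 <= s3 + (height u - q.2) <= s5 by lra.
    by apply: (at_ _ hs); case/param_pieces: hs => [|| []] [? [-> ->]]; lra.
case/param_pieces=> [|| []] [? [-> ->]].
- by left; constructor 1 => /=; lra.
- by right; left => /=; lra.
- by left; constructor 2 => /=; lra.
- by right; right => /=; lra.
- by left; constructor 3 => /=; lra.
Qed.

Lemma param_Jordan : Jordan_arc (curve u).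
Proof.
have [b1 b2 b3 b4 b5] := s_incr; have [e1 e2 e3 e4 e5] := s_lengths.
have s5_gt0 : 0 < s5 by lra.
have s5K (s : R) : s5 * (s / s5) = s by rewrite mulrC divfK // gt_eqF.
exists (fun t => (param_x (s5 * t), param_y (s5 * t))); split.
- apply: continuous_subspaceT.
  have ct : continuous (fun t : R => s5 * t : R).
    by move=> t; apply: cvgM; [exact: cvg_cst|exact: cvg_id].
  apply: continuous_pair => t;
    apply: (@continuous_comp _ _ _ (fun t : R => s5 * t : R)); try exact: ct.
    exact: param_x_continuous.
  exact: param_y_continuous.
- move=> t t'; rewrite !inE /= !in_itv /= => /andP[t0 t1] /andP[t0' t1'] [eX eY].
  have : s5 * t = s5 * t' by apply: param_inj => //; nra.
  by move/mulfI; apply; rewrite gt_eqF.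
- apply/seteqP; split=> q.
    case/param_image=> s /andP[s_ge0 s_le5] <-; exists (s / s5).
      rewrite /= in_itv /=; apply/andP; split.
        by apply: divr_ge0 => //; apply: ltW.
      by rewrite ler_pdivrMr // mul1r.
    by rewrite /= s5K.
  case=> t; rewrite /= in_itv /= => /andP[t0 t1] <-.
  by apply/param_image; exists (s5 * t) => //; nra.
Qed.

End Parametrization.

Lemma curve_Jordan (u : arch) : well_formed u -> Jordan_arc (curve u).
Proof.
case=> w1 w2 w3 [w4 w5 w6].
pose s1 := leg1 u - left_end u; pose s2 := s1 + (height u + bottom1 u).
pose s3 := s2 + (leg2 u - leg1 u); pose s4 := s3 + (height u + bottom2 u).
apply: (@param_Jordan u s1 s2 s3 s4 (s4 + (right_end u - leg2 u)));
  by split; rewrite /s4 /s3 /s2 /s1; lra.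
Qed.

End Arch.

(** * Crossings *)

Lemma fst_continuous (S T : topologicalType) : continuous (@fst S T).
Proof. by move=> [x y]; exact: cvg_fst. Qed.

Lemma snd_continuous (S T : topologicalType) : continuous (@snd S T).
Proof. by move=> [x y]; exact: cvg_snd. Qed.

Lemma homeomorphism_on_global (S T : topologicalType) (h : S -> T) (k : T -> S)
    (U : set S) :
  continuous h -> continuous k -> cancel h k -> cancel k h -> open U ->
  open (k @^-1` U) /\ homeomorphism_on U (k @^-1` U) h.
Proof.
move=> hc kc hk kh oU; split; first by apply: open_comp => // x _; exact: kc.
split.
- split.
  + by move=> x Ux; rewrite /preimage /= hk.
  + by move=> x y _ _ e; rewrite -(hk x) e hk.
  + by move=> y Uy; exists (k y).
- exact: continuous_subspaceT.
- by exists k; split=> // ; exact: continuous_subspaceT.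
Qed.

(** The translation taking [p] to the origin is the required homeomorphism; for
    the other order of the arcs, follow it by the swap of coordinates. *)
Lemma cross_at_axes (R : realType) (A B : set (R * R)) (p : R * R) (a b c d : R) :
  a < p.1 < b -> c < p.2 < d ->
  (forall q, a < q.1 < b -> c < q.2 < d ->
     (A q <-> q.2 = p.2) /\ (B q <-> q.1 = p.1)) ->
  cross_at A B p /\ cross_at B A p.
Proof.
move=> pab pcd AB.
pose U := [set q : R * R | a < q.1 < b /\ c < q.2 < d].
have oU : open U.
  have -> : U = (fst @^-1` `]a, b[) `&` (snd @^-1` `]c, d[).
    by apply/seteqP; split=> q /=; rewrite !in_itv.
  apply: openI.
    apply: (@open_comp (R * R)%type R fst) => [x _|]; last exact: interval_open.
    exact: fst_continuous.
  apply: (@open_comp (R * R)%type R snd) => [x _|]; last exact: interval_open.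
  exact: snd_continuous.
pose sh (e : R * R) (q : R * R) := (q.1 + e.1, q.2 + e.2).
pose sw (q : R * R) := (q.2, q.1).
have shc e : continuous (sh e).
  apply: continuous_pair => q; apply: cvgD; try exact: cvg_cst.
    exact: fst_continuous.
  exact: snd_continuous.
have swc : continuous sw.
  by apply: continuous_pair => q; [exact: snd_continuous|exact: fst_continuous].
pose mp := (- p.1, - p.2).
have shK1 : cancel (sh mp) (sh p).
  by move=> [x y]; rewrite /sh /= !addrNK.
have shK2 : cancel (sh p) (sh mp).
  by move=> [x y]; rewrite /sh /= !addrK.
have swK : cancel sw sw by case.
have swc2 : continuous (sw \o sh mp).
  by move=> q; apply: continuous_comp; [exact: shc|exact: swc].
have swc3 : continuous (sh p \o sw).
  by move=> q; apply: continuous_comp; [exact: swc|exact: shc].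
have K1 : cancel (sw \o sh mp) (sh p \o sw) by move=> q /=; rewrite swK shK1.
have K2 : cancel (sh p \o sw) (sw \o sh mp) by move=> q /=; rewrite shK2 swK.
have [oV hV] := homeomorphism_on_global (shc _) (shc _) shK1 shK2 oU.
have [oW hW] := homeomorphism_on_global swc2 swc3 K1 K2 oU.
have sub0 (x y : R) : (x = y) <-> (x - y = 0).
  by split=> [->|/eqP]; [rewrite subrr|rewrite subr_eq0 => /eqP].
have Ap q : U q -> (A q <-> q.2 - p.2 = 0).
  by case=> q1 q2; have [-> _] := AB _ q1 q2; apply: sub0.
have Bp q : U q -> (B q <-> q.1 - p.1 = 0).
  by case=> q1 q2; have [_ ->] := AB _ q1 q2; apply: sub0.
split.
- by exists U, (sh p @^-1` U), (sh mp); split=> //; rewrite /sh /= !subrr.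
- by exists U, ((sh p \o sw) @^-1` U), (sw \o sh mp); split=> //; rewrite /sh /sw /= !subrr.
Qed.

Section TwoArches.
Variable R : realType.
Implicit Types u v : arch R.

(** The level of the horizontal piece of [u] facing the abscissa [p], when [p] is
    not the abscissa of a leg of [u]. *)
Definition profile u (p : R) : R :=
  if p < leg1 u then - bottom1 u else if p < leg2 u then height u else - bottom2 u.

(** Here [p], [k], [t] describe a leg of another arc, which goes from [- k] up to
    [t]. *)
Definition hits u (p k t : R) :=
  left_end u < p < right_end u /\ - k < profile u p < t.

Definition misses u (p k t : R) :=
  [\/ p < left_end u, right_end u < p, profile u p < - k | t < profile u p].

Definition general_position u v :=
  [/\ leg1 u != leg1 v, leg1 u != leg2 v, leg2 u != leg1 v & leg2 u != leg2 v] /\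
  [/\ bottom1 u != bottom1 v, bottom1 u != bottom2 v, bottom2 u != bottom1 v,
      bottom2 u != bottom2 v & height u != height v].

Lemma general_position_sym u v : general_position u v -> general_position v u.
Proof.
by case=> [[? ? ? ?] [? ? ? ? ?]]; do 2?split; rewrite eq_sym.
Qed.

Lemma horizontals_profile u q : well_formed u -> horizontals u q ->
  q.1 != leg1 u -> q.1 != leg2 u ->
  left_end u <= q.1 <= right_end u /\ q.2 = profile u q.1.
Proof.
case=> w1 w2 w3 _ h n1 n2; have n1' : q.1 < leg1 u \/ leg1 u < q.1.
  by apply/orP; rewrite -neq_lt.
have n2' : q.1 < leg2 u \/ leg2 u < q.1 by apply/orP; rewrite -neq_lt.
rewrite /profile; case: h => -[h1 ->]; (split; first by lra);
  case: ltP => ?; try case: ltP => ?; lra.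
Qed.

Lemma misses_horizontals u p k t : well_formed u -> p != leg1 u -> p != leg2 u ->
  misses u p k t -> forall y, - k <= y <= t -> ~ horizontals u (p, y).
Proof.
move=> wu n1 n2 m y hy /(horizontals_profile wu)/(_ n1 n2)/= [hp ey].
by case: m; lra.
Qed.

Lemma misses_verticals u v : well_formed u -> general_position u v ->
  misses u (leg1 v) (bottom1 v) (height v) ->
  misses u (leg2 v) (bottom2 v) (height v) ->
  horizontals u `&` verticals v = set0.
Proof.
move=> wu [[n1 n2 n3 n4] _] m1 m2; apply/seteqP; split=> // -[p y] [hu] /=.
by case=> /= -[ep hy]; move: hu; rewrite ep;
  [apply: (misses_horizontals _ _ _ m1)|apply: (misses_horizontals _ _ _ m2)];
  rewrite // eq_sym.
Qed.

Lemma horizontals_disjoint u v : well_formed u -> well_formed v ->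
  general_position u v -> horizontals u `&` horizontals v = set0.
Proof.
move=> [_ _ _ [u1 u2 u3]] [_ _ _ [v1 v2 v3]].
move=> [_ [/eqP n1 /eqP n2 /eqP n3 /eqP n4 /eqP n5]].
apply/seteqP; split=> // q [/= hu hv].
have {}hu : [\/ q.2 = - bottom1 u, q.2 = height u | q.2 = - bottom2 u].
  by case: hu => -[_]; [constructor 1|constructor 2|constructor 3].
have {}hv : [\/ q.2 = - bottom1 v, q.2 = height v | q.2 = - bottom2 v].
  by case: hv => -[_]; [constructor 1|constructor 2|constructor 3].
case: hu hv => eu [] ev;
 [apply: n1|exfalso|apply: n2|exfalso|apply: n5|exfalso|apply: n3|exfalso|apply: n4]; lra.
Qed.

Lemma verticals_disjoint u v :
  general_position u v -> verticals u `&` verticals v = set0.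
Proof.
move=> [[/eqP n1 /eqP n2 /eqP n3 /eqP n4] _].
apply/seteqP; split=> // q [] [] [/= e _] [] [/= e' _]; rewrite e in e'.
- exact: n1.
- exact: n2.
- exact: n3.
- exact: n4.
Qed.

(** The legs of [u] avoid [v], horizontal pieces lie at different levels and
    legs at different abscissas: only legs of [v] can meet [u]. *)
Lemma curveI u v : well_formed u -> well_formed v -> general_position u v ->
  misses v (leg1 u) (bottom1 u) (height u) ->
  misses v (leg2 u) (bottom2 u) (height u) ->
  curve u `&` curve v = horizontals u `&` verticals v.
Proof.
move=> wu wv uv m1 m2.
have cE w : curve w = horizontals w `|` verticals w by [].
rewrite !cE setIUl (setIUr (horizontals u) (horizontals v)).
rewrite (setIUr (verticals u) (horizontals v)).
rewrite horizontals_disjoint // set0U verticals_disjoint //.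
rewrite [verticals u `&` _]setIC (@misses_verticals v u) ?setU0 //.
exact: general_position_sym.
Qed.

(** The two orders are recorded as [cross_at] treats its two sets differently. *)
Definition crossing (A B : set (R * R)) :=
  exists p, A `&` B = [set p] /\ (cross_at A B p /\ cross_at B A p).

Lemma crossing_sym A B : crossing A B -> crossing B A.
Proof. by move=> [p [AB [c1 c2]]]; exists p; rewrite setIC. Qed.

Lemma curve_local u p : well_formed u -> left_end u < p < right_end u ->
  p != leg1 u -> p != leg2 u ->
  exists a b, a < p < b /\
    forall q, a < q.1 < b -> curve u q <-> q.2 = profile u p.
Proof.
move=> [w1 w2 w3 _] hp; rewrite !neq_lt /profile => /orP n1 /orP n2.
case: ltP => p1; [|case: ltP => p2].
- exists (left_end u), (leg1 u); split=> [|q hq]; first by lra.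
  split=> [|e]; last by left; constructor 1 => /=; lra.
  by case=> [[]|[]] []; lra.
- exists (leg1 u), (leg2 u); split=> [|q hq]; first by lra.
  split=> [|e]; last by left; constructor 2 => /=; lra.
  by case=> [[]|[]] []; lra.
- exists (leg2 u), (right_end u); split=> [|q hq]; first by lra.
  split=> [|e]; last by left; constructor 3 => /=; lra.
  by case=> [[]|[]] []; lra.
Qed.

Lemma curve_leg1 u q : well_formed u -> left_end u < q.1 < leg2 u ->
  - bottom1 u < q.2 < height u -> curve u q <-> q.1 = leg1 u.
Proof.
move=> [w1 w2 w3 [w4 w5 w6]] h1 h2; split=> [|e]; last by right; left => /=; lra.
by case=> [[]|[]] []; lra.
Qed.

Lemma curve_leg2 u q : well_formed u -> leg1 u < q.1 < right_end u ->
  - bottom2 u < q.2 < height u -> curve u q <-> q.1 = leg2 u.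
Proof.
move=> [w1 w2 w3 [w4 w5 w6]] h1 h2; split=> [|e]; last by right; right => /=; lra.
by case=> [[]|[]] []; lra.
Qed.

Lemma disjoint_curves u v : well_formed u -> well_formed v -> general_position u v ->
  misses v (leg1 u) (bottom1 u) (height u) ->
  misses v (leg2 u) (bottom2 u) (height u) ->
  misses u (leg1 v) (bottom1 v) (height v) ->
  misses u (leg2 v) (bottom2 v) (height v) ->
  curve u `&` curve v = set0.
Proof. by move=> wu wv uv *; rewrite curveI ?misses_verticals. Qed.

(** Around the crossing point, [u] is a horizontal line between two consecutive
    corner abscissas, and [v] a vertical line away from its other leg and its
    horizontal pieces; their common rectangle is the neighbourhood required by
    [cross_at_axes]. *)
Lemma crossing_curves u v : well_formed u -> well_formed v -> general_position u v ->
  misses v (leg1 u) (bottom1 u) (height u) ->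
  misses v (leg2 u) (bottom2 u) (height u) ->
  hits u (leg1 v) (bottom1 v) (height v) /\
    misses u (leg2 v) (bottom2 v) (height v) \/
  misses u (leg1 v) (bottom1 v) (height v) /\
    hits u (leg2 v) (bottom2 v) (height v) ->
  crossing (curve u) (curve v).
Proof.
move=> wu wv uv m1 m2 hv; rewrite /crossing curveI //.
have [[n1 n2 n3 n4] _] := uv; have [v1 v2 v3 _] := wv; have [u1 u2 u3 _] := wu.
case: hv => -[].
- move=> [hp hk] m; exists (leg1 v, profile u (leg1 v)).
  have [||a [b [hab loc]]] := curve_local wu hp; rewrite 1?eq_sym //; split.
    apply/seteqP; split=> [[p y] [hu [] /= [ep hy]]|_ ->].
    + subst p; have := horizontals_profile wu hu.
      by rewrite /= eq_sym n1 eq_sym n3 => /(_ isT isT)[_ ->].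
    + move: hu; rewrite ep => hu; exfalso; move: hu.
      by apply: (misses_horizontals wu _ _ m); rewrite // eq_sym.
    + split; last by left => /=; lra.
      have /(loc _) : a < (leg1 v, profile u (leg1 v)).1 < b by [].
      case=> _ /(_ erefl) [//|[]] [/= /eqP].
        by rewrite eq_sym (negPf n1).
      by rewrite eq_sym (negPf n3).
  apply: (@cross_at_axes R _ _ _ (Num.max a (left_end v)) (Num.min b (leg2 v))
     (- bottom1 v) (height v)) => //=.
    by rewrite gt_max lt_min; lra.
  move=> q; rewrite gt_max lt_min => hq1 hq2.
  by split; [apply: loc|apply: (curve_leg1 wv)]; lra.
- move=> m [hp hk]; exists (leg2 v, profile u (leg2 v)).
  have [||a [b [hab loc]]] := curve_local wu hp; rewrite 1?eq_sym //; split.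
    apply/seteqP; split=> [[p y] [hu [] /= [ep hy]]|_ ->].
    + move: hu; rewrite ep => hu; exfalso; move: hu.
      by apply: (misses_horizontals wu _ _ m); rewrite // eq_sym.
    + subst p; have := horizontals_profile wu hu.
      by rewrite /= eq_sym n2 eq_sym n4 => /(_ isT isT)[_ ->].
    + split; last by right => /=; lra.
      have /(loc _) : a < (leg2 v, profile u (leg2 v)).1 < b by [].
      case=> _ /(_ erefl) [//|[]] [/= /eqP].
        by rewrite eq_sym (negPf n2).
      by rewrite eq_sym (negPf n4).
  apply: (@cross_at_axes R _ _ _ (Num.max a (leg1 v)) (Num.min b (right_end v))
     (- bottom2 v) (height v)) => //=.
    by rewrite gt_max lt_min; lra.
  move=> q; rewrite gt_max lt_min => hq1 hq2.
  by split; [apply: loc|apply: (curve_leg2 wv)]; lra.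
Qed.

End TwoArches.

(** * The drawing *)

(** For each value of [H] there is a band of levels of width [2 * M], with [M]
    larger than all positions.  In it, the values of [lv] go up from the lower
    limit and those of [hv] go down from the upper limit, both by the position
    of the first leg; they do not meet as [M] is large. *)
Lemma layout_levels (V : finType) (x H : V -> nat) :
  exists lv hv : V -> nat,
    [/\ forall v, (0 < lv v < hv v)%N,
        forall v w, (H v < H w)%N -> (hv v < lv w)%N &
        forall v w, H v = H w -> (x v < x w)%N ->
          (lv v < lv w)%N /\ (hv w < hv v)%N].
Proof.
pose M := (\max_v x v).+2.
have xM v : (x v < M.-1)%N by rewrite ltnS (leq_bigmax v).
exists (fun v => 2 * H v * M + (x v).+1)%N.
exists (fun v => (2 * H v + 2) * M - (x v).+1)%N.
split=> [v|v w Hvw|v w Hvw xvw].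
- by have := xM v; nia.
- by have := (xM v, xM w); case; nia.
- by have := (xM v, xM w); rewrite Hvw; case; nia.
Qed.

Section Drawing.
Variables (R : realType) (G : sgraph) (x0 x1 x2 x3 H lv hv : G -> nat).

Definition drawn v : arch R :=
  Arch (x0 v)%:R (x1 v)%:R (x2 v)%:R (x3 v)%:R (lv v)%:R (hv v)%:R (hv v)%:R.

Hypothesis lay : layout x0 x1 x2 x3 H.
Hypothesis lv_hv : forall v, (0 < lv v < hv v)%N.
Hypothesis levels_lt : forall v w, (H v < H w)%N -> (hv v < lv w)%N.
Hypothesis levels_eq : forall v w, H v = H w -> (x1 v < x1 w)%N ->
  (lv v < lv w)%N /\ (hv w < hv v)%N.

Lemma drawn_well_formed v : well_formed (drawn v).
Proof.
have [/(_ v)[h1 h2 h3] _ _ _] := lay; have := lv_hv v => /andP[h4 h5].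
by split; rewrite ?ltr_nat //; split; rewrite ltr0n //; lia.
Qed.

Lemma misses_strictly_outside v n k t : strictly_outside n (x0 v) (x3 v) ->
  misses (drawn v) n%:R k t.
Proof.
by rewrite /strictly_outside => /orP[] h;
  [constructor 1|constructor 2]; rewrite ltr_nat.
Qed.

Lemma profile_drawn v p :
  [\/ profile (drawn v) p = - (lv v)%:R, profile (drawn v) p = (hv v)%:R
    | profile (drawn v) p = - (hv v)%:R].
Proof.
rewrite /profile /=; case: ifP => _; first by constructor 1.
by case: ifP => _; [constructor 2|constructor 3].
Qed.

(** The legs of [v] are shorter than all levels of [w], and those of [w] longer
    than all levels of [v]. *)
Lemma draw_adjacency_lt v w : (H v < H w)%N ->
  if adj v w then crossing (curve (drawn v)) (curve (drawn w))
  else curve (drawn v) `&` curve (drawn w) = set0.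
Proof.
move=> Hvw; have [_ inj /(_ _ _ Hvw) lt _] := lay.
have vw : v != w by apply: contraTneq Hvw => ->; rewrite ltnn.
have wv : w != v by rewrite eq_sym.
have := levels_lt Hvw; have /andP[] := lv_hv v; have /andP[] := lv_hv w.
rewrite -![(_ < _)%N](ltr_nat R) => hw1 hw2 hv1 hv2 hvw.
have gen : general_position (drawn v) (drawn w).
  have [n1 n2 n3] := inj _ _ vw; have [_ n4 _] := inj w v wv.
  split; first by split; rewrite /= eqr_nat // eq_sym n4 // eq_sym.
  by split; rewrite /= lt_eqF //; lra.
have miss p (k : R) : k <= (hv v)%:R -> misses (drawn w) p k (hv v)%:R.
  move=> kh; rewrite /misses; have [->|->|->] := profile_drawn w p.
  - by constructor 3; lra.
  - by constructor 4; lra.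
  - by constructor 3; lra.
have hit n (k : R) : strictly_inside n (x0 v) (x3 v) -> (lv w)%:R <= k ->
    hits (drawn v) n%:R k (hv w)%:R.
  move=> /andP[n0 n3] kl; split; first by rewrite !ltr_nat n0.
  by have [->|->|->] := profile_drawn v n%:R; lra.
have wfv := drawn_well_formed v; have wfw := drawn_well_formed w.
have lvm : (lv v)%:R <= (hv v)%:R :> R by exact: ltW.
have lwm : (lv w)%:R <= (hv w)%:R :> R by exact: ltW.
move: lt; case: ifP => _.
  move=> h; apply: crossing_curves => //; try exact: miss.
  case/orP: h => /andP[h1 h2]; [left|right]; split;
    by [exact: hit|exact: misses_strictly_outside].
move=> /andP[h1 h2]; apply: disjoint_curves => //;
  by [exact: miss|exact: misses_strictly_outside].
Qed.

(** When the tops agree, the right leg of [v] is longer than all levels of [w]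
    and crosses the arc of [w] once.  The left leg of [v], standing left of both
    legs of [w], faces the left piece of [w], which runs below its foot.  Both
    legs of [w] stand right of the left leg of [v], where the levels of [v] are
    [hv v] and [- hv v], out of their reach. *)
Lemma draw_adjacency_eq v w : H v = H w -> (x1 v < x1 w)%N ->
  if adj v w then crossing (curve (drawn w)) (curve (drawn v))
  else curve (drawn w) `&` curve (drawn v) = set0.
Proof.
move=> Hvw xvw; have [ord inj _ eqH] := lay.
have vw : v != w by apply: contraTneq xvw => ->; rewrite ltnn.
have wv : w != v by rewrite eq_sym.
have ltw := eqH _ _ (esym Hvw) wv; have sep := eqH _ _ Hvw vw.
have [] := levels_eq Hvw xvw; have /andP[] := lv_hv v; have /andP[] := lv_hv w.
rewrite -![(_ < _)%N](ltr_nat R) => hw1 hw2 hv1 hv2 l12 h21.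
have gen : general_position (drawn w) (drawn v).
  have [n1 n2 n3] := inj _ _ wv; have [_ n4 _] := inj _ _ vw.
  split; first by split; rewrite /= eqr_nat // eq_sym n4.
  split; rewrite /= ?(gt_eqF l12) ?(lt_eqF h21) //.
  - by rewrite lt_eqF //; lra.
  - by rewrite gt_eqF //; lra.
have wfv := drawn_well_formed v; have wfw := drawn_well_formed w.
have [d1 d2 d3] := ord v; have [e1 e2 e3] := ord w.
move: sep; case: ifP => [vwE|vwE].
  rewrite adj_sym vwE in ltw; move/andP: ltw => [/andP[iv1 iv2] /andP[iv3 iv4]].
  move=> /andP[/andP[iw1 iw2] /andP[iw3 iw4]].
  apply: crossing_curves => //.
  - have : (x1 v)%:R < (x1 w)%:R :> R by rewrite ltr_nat.
    move=> c; rewrite /misses /profile /= (ltNge _ (x1 v)%:R) (ltW c) /=.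
    case: ifP => _; [constructor 4|constructor 3]; lra.
  - have : (x1 v)%:R < (x2 w)%:R :> R by rewrite ltr_nat (ltn_trans xvw).
    move=> c; rewrite /misses /profile /= (ltNge _ (x1 v)%:R) (ltW c) /=.
    case: ifP => _; [constructor 4|constructor 3]; lra.
  - right; split.
      constructor 3; rewrite /profile /= ltr_nat xvw; lra.
    split; first by rewrite /= !ltr_nat iv3.
    by have [->|->|->] := profile_drawn w (x2 v)%:R; rewrite /=; lra.
move=> /orP[] h.
  by apply: disjoint_curves => //; apply: misses_strictly_outside;
    move: d1 d2 d3 e1 e2 e3 h; rewrite /strictly_outside; clear; lia.
by apply: disjoint_curves => //; apply: misses_strictly_outside;
  move: d1 d2 d3 e1 e2 e3 h; rewrite /strictly_outside; clear; lia.
Qed.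

Lemma crossing_distinct v w : v != w ->
  if adj v w then crossing (curve (drawn v)) (curve (drawn w))
  else curve (drawn v) `&` curve (drawn w) = set0.
Proof.
have sym a b : (if adj a b then crossing (curve (drawn a)) (curve (drawn b))
    else curve (drawn a) `&` curve (drawn b) = set0) ->
  if adj b a then crossing (curve (drawn b)) (curve (drawn a))
  else curve (drawn b) `&` curve (drawn a) = set0.
  rewrite (adj_sym b); case: ifP => _; first exact: crossing_sym.
  by rewrite setIC.
have symE a b : (if adj a b then crossing (curve (drawn b)) (curve (drawn a))
    else curve (drawn b) `&` curve (drawn a) = set0) ->
  if adj a b then crossing (curve (drawn a)) (curve (drawn b))
  else curve (drawn a) `&` curve (drawn b) = set0.
  by case: ifP => _; [exact: crossing_sym|rewrite setIC].
move=> vw; have [Hvw|Hvw|Hvw] := ltngtP (H v) (H w).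
- exact: draw_adjacency_lt.
- exact/sym/draw_adjacency_lt.
have [_ inj _ _] := lay; have [n1 _ _] := inj _ _ vw.
have [xvw|xvw|xvw] := ltngtP (x1 v) (x1 w).
- exact/symE/draw_adjacency_eq.
- exact/sym/symE/draw_adjacency_eq.
- by rewrite xvw eqxx in n1.
Qed.

End Drawing.

Theorem theorem1 (R : realType) (G : sgraph) :
  VPT_graph G -> PSI_representable R G.
Proof.
move=> /VPT_layout[x0 [x1 [x2 [x3 [H lay]]]]].
have [lv [hv [lv_hv levels_lt levels_eq]]] := layout_levels x1 H.
pose A v := curve (drawn R x0 x1 x2 x3 lv hv v).
have wf v : well_formed (drawn R x0 x1 x2 x3 lv hv v) := drawn_well_formed R lay lv_hv v.
have cross v w : v != w -> if adj v w then crossing (A v) (A w) else A v `&` A w = set0.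
  exact: (crossing_distinct R lay lv_hv levels_lt levels_eq).
(* Equal arcs of distinct vertices would have at most one point. *)
have A_inj v w : A v = A w -> v = w.
  move=> AvAw; apply/eqP/negPn/negP => vw.
  have [w1 w2 w3 _] := wf v.
  have Al : A v ((x0 v)%:R, - (lv v)%:R).
    by left; constructor 1 => /=; move: w1 => /=; lra.
  have Ar : A v ((x3 v)%:R, - (hv v)%:R).
    by left; constructor 3 => /=; move: w3 => /=; lra.
  have := cross v w vw; rewrite -AvAw setIid; case: ifP => _.
    move=> [p [eA _]]; rewrite setIid in eA; rewrite eA in Al Ar.
    move: Ar; rewrite -Al => -[e _].
    by move: w1 w2 w3 => /=; lra.
  by move=> eA; rewrite eA in Al.
exists (range A); split.
  split=> [_ [v _ <-]|_ _ [v _ <-] [w _ <-] AvAw].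
    exact: curve_Jordan.
  have vw : v != w by apply: contra_notN AvAw => /eqP ->.
  have := cross v w vw; case: ifP => _; last by left.
  by move=> [p [eA [c _]]]; right; exists p.
exists A; split.
  split=> [v _|v w _ _|_ [v _ <-]]; [by exists v|exact: A_inj|by exists v].
move=> v w vw; have := cross v w vw; case: ifP => _.
  by move=> [p [eA _]]; split=> // _; exists p; rewrite eA.
by move=> eA; split=> // -[p]; rewrite eA.
Qed.
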